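(* Let $\alpha>0$, and let $Z_1,\dots,Z_n$ be generated from (possibly dependent) random variables $X_1,\dots,X_n$, whose joint distribution depends on a real parameter $\theta$, by an arbitrary (sequentially interactive or non-interactive) $\alpha$-locally differentially private mechanism. With the conditional Fisher informations $I(\cdot\mid\cdot)$ about $\theta$ defined in the context: for all $i=1,\dots,n$, $$I(Z_i\mid Z_{1:(i-1)})\lesssim(e^\alpha-1)^2\,I(X_i\mid Z_{1:(i-1)}),$$ where by convention there is no conditioning when $i=1$. Moreover, for $i\ge2$ and arbitrary $\epsilon>0$, $$I(X_i\mid Z_{1:(i-1)})\le\Big(1+\frac1\epsilon\Big)(e^\alpha-1)^2\,I(X_i,X_{i-1}\mid Z_{1:(i-2)})+(1+\epsilon)e^{2\alpha}\,I(X_i\mid Z_{1:(i-2)}),$$ and $$I(X_i\mid Z_{1:(i-1)})\le\Big(1+\frac94(e^\alpha-1)^2\Big)\Big(I(X_i,X_{i-1}\mid Z_{1:(i-2)})+I(X_i\mid Z_{1:(i-2)})\Big).$$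
   Context: Notation: $Z_{1:k}=(Z_1,\dots,Z_k)$, with $Z_{1:0}$ empty (no conditioning); $\lesssim$ means $\le$ up to an absolute multiplicative constant. Mechanism: $Z_i$ is drawn, given all the $X$'s and $Z_{1:(i-1)}$, from a conditional distribution $Q_i(\cdot\mid X_i,Z_{1:(i-1)})$ which does not depend on $\theta$, depends only on $X_i$ and $Z_{1:(i-1)}$, has density $q^{Z_i\mid X_i,Z_{1:(i-1)}}$, and is $\alpha$-locally differentially private: $q^{Z_i\mid X_i=x,Z_{1:(i-1)}}(z)\le e^\alpha q^{Z_i\mid X_i=x',Z_{1:(i-1)}}(z)$ for all $x,x',z$ and all values of $Z_{1:(i-1)}$. Likelihoods: for random vectors $U$ and $V$ (built from the $X$'s and $Z$'s), $\mathcal L_\theta^{U\mid V}$ is the conditional density of $U$ given $V$ under parameter $\theta$, and $\dot{\mathcal L}_\theta^{U\mid V}$ its derivative in $\theta$. Densities are assumed to exist and to be regular in $\theta$ (differentiable, with differentiation under the integral sign permitted). Conditional Fisher information: $I(U\mid V)=\mathbb E_V\left[\int\frac{(\dot{\mathcal L}_\theta^{U\mid V}(u))^2}{\mathcal L_\theta^{U\mid V}(u)}\,du\right]$, the Fisher information of the conditional law of $U$ given $V$ averaged over $V$; without conditioning this is the usual Fisher information $I(U)$. *)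

(* Defs.v *)
From HB Require Import structures.
From mathcomp Require Import all_boot all_order all_algebra.
From mathcomp Require Import all_classical all_reals all_analysis.

Set Implicit Arguments.
Unset Strict Implicit.
Unset Printing Implicit Defensive.

Import Order.TTheory GRing.Theory Num.Theory.
Import numFieldNormedType.Exports.

Local Open Scope classical_set_scope.
Local Open Scope ring_scope.

(* Indices are 0-based: for i : 'I_n, [inl i] names the variable X_(i+1) and
   [inr i] names its privatized version Z_(i+1). *)
Notation var n := ('I_n + 'I_n)%type.

(* The first k of the Z's; [pastZ n 0] is empty. *)
Definition pastZ (n k : nat) : {set var n} :=
  [set v : var n | if v is inr l then (l < k)%N else false]%SET.

Definition allX (n : nat) : {set var n} :=
  [set v : var n | if v is inl _ then true else false]%SET.

Section Model.
Context (R : realType) (n : nat) (d : var n -> measure_display)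
  (T : forall v, measurableType (d v))
  (mu : forall v, {sigma_finite_measure set (T v) -> \bar R}).

(* A joint value of all the variables. *)
Definition config := forall v, T v.

(* The cylinders over one coordinate; they generate the product
   sigma-algebra on [config]. *)
Definition coordinate_sets : set (set config) :=
  [set A | exists v (B : set (T v)), measurable B /\ A = [set w | B (w v)]].

Definition config_measurable (f : config -> R) : Prop :=
  measurable_fun [set: g_sigma_algebraType coordinate_sets] f.

Definition depends_only_on (U : Type) (S : {set var n}) (f : config -> U) :=
  forall w w', (forall v, v \in S -> w v = w' v) -> f w = f w'.

(* Integral of f over the coordinates in S against the product of the
   corresponding mu v, written as an iterated integral; the coordinates
   outside S are kept at their value in w. *)
Definition integral_over (S : {set var n}) (f : config -> \bar R) :
    config -> \bar R :=
  foldr (fun v g (w : config) => (\int[mu v]_t g (dfwith w v t))%E) f (enum S).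

(* [p theta] is the joint density of X_1, ..., X_n under theta. *)
Definition density_family (Theta : set R) (p : R -> config -> R) : Prop :=
  forall theta, Theta theta ->
  [/\ config_measurable (p theta), (forall w, 0 <= p theta w),
      depends_only_on (allX n) (p theta) &
      forall w, integral_over (allX n) (fun w' => (p theta w')%:E) w = 1%E].

(* [q i w] is the value at z = w (inr i) of the conditional density of the
   i-th Z given the i-th X and the previous Z's, which take their values
   in w. The last clause is alpha-local differential privacy. *)
Definition ldp_mechanism (alpha : R) (q : 'I_n -> config -> R) : Prop :=
  forall i : 'I_n,
  [/\ config_measurable (q i), (forall w, 0 <= q i w),
      depends_only_on (inl i |: pastZ n i.+1)%SET (q i),
      (forall w : config, (\int[mu (inr i)]_z (q i (dfwith w (inr i) z))%:E)%E = 1%E) &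
      forall (w : config) (x x' : T (inl i)),
        q i (dfwith w (inl i) x) <= expR alpha * q i (dfwith w (inl i) x')].

Section Likelihood.
Context (p : R -> config -> R) (q : 'I_n -> config -> R).

(* Each Z_i being drawn given all the X's and the previous Z's from the
   density q i, this is the joint density of all the X's and Z's. *)
Definition joint (theta : R) (w : config) : R :=
  p theta w * \prod_(i < n) q i w.

(* Marginal density of the variables in S. *)
Definition lik (S : {set var n}) (theta : R) (w : config) : R :=
  fine (integral_over (~: S)%SET (fun w' => (joint theta w')%:E) w).

(* Conditional density of U given V. It is 0 where the density of V vanishes,
   a set that carries no mass under the law of V. *)
Definition cond_lik (U V : {set var n}) (theta : R) (w : config) : R :=
  lik (U :|: V)%SET theta w / lik V theta w.

Definition cond_lik_dot (U V : {set var n}) (theta : R) (w : config) : R :=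
  ((fun t => cond_lik U V t w)^`())%classic theta.

(* The integrals range over all the coordinates on which the integrand
   depends, so the base point is immaterial. For V empty, lik V theta = 1
   and this is the unconditional Fisher information of U. *)
Definition fisher (theta : R) (U V : {set var n}) : \bar R :=
  integral_over V (fun v =>
    (lik V theta v)%:E *
    integral_over U (fun w =>
      ((cond_lik_dot U V theta w) ^+ 2 / cond_lik U V theta w)%:E) v)%E
  point.

(* Every marginal density is real-valued and differentiable in theta, with
   derivative obtained by differentiating under the integral sign; for S the
   set of all variables this is the differentiability of [joint] itself. *)
Definition regular (Theta : set R) : Prop :=
  forall theta, Theta theta -> forall (S : {set var n}) (w : config),
  let joint_dot w' := ((fun t => joint t w')^`())%classic theta in
  [/\ (integral_over (~: S)%SET (fun w' => (joint theta w')%:E) w < +oo)%E,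
      derivable (fun t => lik S t w) theta 1,
      (integral_over (~: S)%SET (fun w' => `|joint_dot w'|%:E) w < +oo)%E &
      (((fun t => lik S t w)^`())%classic theta)%:E =
        integral_over (~: S)%SET (fun w' => (joint_dot w')%:E) w].

End Likelihood.
End Model.

(* Main.v *)
(** Write f_S for the marginal density of the variables in S, f'_S for its
    derivative in theta. On the fibre over V, I(U | V) is the integral over U of
    (f'_{UV} - s f_{UV})^2 / f_{UV} for s = f'_V / f_V, and this s minimizes the
    integral. If S contains Z_1, ..., Z_{j-1} and no later Z, then
    f_{S,Z_j} is the integral of f_{S,X_j} k(z | x) over x, where k is the density
    of the mechanism, and likewise for f'. Privacy makes k(z | x) differ from its
    mean kappa = f_{S,Z_j} / f_S by at most (e^alpha - 1) kappa. Splitting k into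
    kappa and this difference, Cauchy-Schwarz bounds
    (f'_{S,Z_j} - s f_{S,Z_j})^2 / f_{S,Z_j}, for any s, by kappa times
      (1 + 1/eps) (e^alpha - 1)^2 int (f'_{S,X_j} - s f_{S,X_j})^2 / f_{S,X_j} dx
      + (1 + eps) (f'_S - s f_S)^2 / f_S,
    and kappa integrates to 1 over z. With S = Z_{1:i-1} and s its score, the last
    term vanishes and the first inequality follows. With S = (Z_{1:i-2}, X_i),
    s the score of Z_{1:i-2} and j = i - 1, integrating over x_i gives the second
    inequality, even without the factor e^{2 alpha}; the third is the choice
    eps = 9/4 (e^alpha - 1)^2. *)

Require Import Defs.
From HB Require Import structures.
From mathcomp Require Import all_boot all_order all_algebra.
From mathcomp Require Import all_classical all_reals all_analysis.
From mathcomp Require Import measurable_realfun ring lra.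
Import Order.TTheory GRing.Theory Num.Theory.
Import numFieldNormedType.Exports.
Local Open Scope classical_set_scope.
Local Open Scope ring_scope.

Set Implicit Arguments.
Unset Strict Implicit.
Unset Printing Implicit Defensive.

(** * Iterated integrals over coordinates *)

Section Iint.
Context (R : realType) (n : nat) (d : var n -> measure_display)
  (T : forall v, measurableType (d v))
  (mu : forall v, {sigma_finite_measure set (T v) -> \bar R}).

Notation cfg := (g_sigma_algebraType (@coordinate_sets n d T)).

Lemma measurable_coordinate v : measurable_fun [set: cfg] (fun w : cfg => w v).
Proof.
move=> _ B mB; rewrite setTI; apply: sub_sigma_algebra.
by exists v, B.
Qed.

Lemma measurable_to_config d' (S : measurableType d') (f : S -> cfg) :
  (forall v, measurable_fun [set: S] (fun x => f x v)) -> measurable_fun [set: S] f.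
Proof.
move=> mf; apply: (@measurability _ _ _ cfg setT f (@coordinate_sets n d T)) => //.
move=> _ [_ [v [B [mB ->]]] <-].
by have := mf v measurableT B mB.
Qed.

Lemma measurable_dfwith v :
  measurable_fun [set: (cfg * T v)%type] (fun x => dfwith (x.1 : config T) v x.2 : cfg).
Proof.
apply: measurable_to_config => v'.
have [<-|ne] := eqVneq v v'.
  apply: (@eq_measurable_fun _ _ _ _ setT snd); last exact: measurable_snd.
  by move=> x _; rewrite dfwithin.
apply: (@eq_measurable_fun _ _ _ _ setT (fun x : cfg * T v => x.1 v')).
  by move=> x _; rewrite dfwithout.
by apply: (measurableT_comp (@measurable_coordinate v')); exact: measurable_fst.
Qed.

Lemma dfwithC (w : config T) v v' t t' : v != v' ->
  dfwith (dfwith w v t) v' t' = dfwith (dfwith w v' t') v t.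
Proof.
move=> ne; apply: functional_extensionality_dep => u.
have [<-|nu] := eqVneq v u.
  by rewrite dfwithin dfwithout 1?eq_sym// dfwithin.
rewrite [RHS]dfwithout//; have [<-|nu'] := eqVneq v' u; first by rewrite !dfwithin.
by rewrite !dfwithout.
Qed.

(** [integral_over] along an arbitrary list instead of [enum S], so that coordinates can be
    reordered and inductions run on the list. *)
Definition iint (s : seq (var n)) (f : config T -> \bar R) : config T -> \bar R :=
  foldr (fun v g (w : config T) => (\int[mu v]_t g (dfwith w v t))%E) f s.

Definition nn_measurable (f : config T -> \bar R) :=
  (forall w, 0 <= f w)%E /\ measurable_fun [set: cfg] f.

Lemma measurable_section (f : config T -> \bar R) (w : config T) v :
  measurable_fun [set: cfg] f ->
  measurable_fun [set: T v] (fun t => f (dfwith w v t)).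
Proof.
move=> mf; have := measurableT_comp mf (@measurable_dfwith v).
by move=> /(measurable_fun_pair2 (w : cfg)).
Qed.

Lemma nn_measurable_integral v f : nn_measurable f ->
  nn_measurable (fun w => \int[mu v]_t f (dfwith w v t))%E.
Proof.
move=> [f0 mf]; split=> [w|]; first exact: integral_ge0.
apply: (@measurable_fun_fubini_tonelli_F _ _ cfg (T v) R (mu v)
  (fun x => f (dfwith (x.1 : config T) v x.2))) => //.
exact: (measurableT_comp mf (@measurable_dfwith v)).
Qed.

Lemma nn_measurable_iint s f : nn_measurable f -> nn_measurable (iint s f).
Proof. by move=> nnf; elim: s => //= v s; exact: nn_measurable_integral. Qed.

Lemma integral_swap v v' f w : nn_measurable f ->
  (\int[mu v]_t \int[mu v']_t' f (dfwith (dfwith w v t) v' t') =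
   \int[mu v']_t' \int[mu v]_t f (dfwith (dfwith w v' t') v t))%E.
Proof.
move=> [f0 mf]; have [<-//|ne] := eqVneq v v'.
transitivity (\int[mu v']_t' \int[mu v]_t f (dfwith (dfwith w v t) v' t'))%E.
  apply: (fubini_tonelli (fun x : T v * T v' =>
    f (dfwith (dfwith w v x.1) v' x.2))) => //.
  apply: (measurableT_comp (f := f : cfg -> _) mf).
  apply: (measurableT_comp (f := fun x : cfg * T v' =>
    dfwith (x.1 : config T) v' x.2 : cfg) (@measurable_dfwith v')
    (g := fun x : T v * T v' => (dfwith w v x.1 : cfg, x.2))).
  apply: measurable_fun_pair => //=.
  apply: (measurableT_comp (f := fun x : cfg * T v =>
    dfwith (x.1 : config T) v x.2 : cfg) (@measurable_dfwith v)
    (g := fun x : T v * T v' => (w : cfg, x.1))).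
  by apply: measurable_fun_pair.
by apply: eq_integral => t' _; apply: eq_integral => t _; rewrite dfwithC.
Qed.

Lemma iint_swap v v' s f : nn_measurable f ->
  iint [:: v, v' & s] f = iint [:: v', v & s] f.
Proof.
by move=> nnf; apply/funext => w /=; exact/integral_swap/nn_measurable_iint.
Qed.

(** Tonelli swaps two adjacent coordinates; swaps bring the head of [s'] to the front of [s], and
    induction does the rest. *)
Lemma iint_perm s s' f : nn_measurable f -> perm_eq s s' -> iint s f = iint s' f.
Proof.
move=> nnf; elim: s' s => [|x t IH] s pst.
  by have /nilP -> : nilp s by rewrite /nilp (perm_size pst).
have xs : x \in s by rewrite (perm_mem pst) mem_head.
case/splitPr: xs pst => s1 s2.
rewrite -(cat1s x s2) perm_catCA /= perm_cons => /IH <-.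
elim: s1 => //= y s1 ->.
by have := iint_swap y x (s1 ++ s2) nnf.
Qed.

Lemma iint_cat s s' f : iint (s ++ s') f = iint s (iint s' f).
Proof. exact: foldr_cat. Qed.

Lemma integral_overU (A B : {set var n}) f : nn_measurable f -> [disjoint A & B]%B ->
  integral_over mu (A :|: B)%SET f = integral_over mu A (integral_over mu B f).
Proof.
move=> nnf dAB; rewrite -[RHS]iint_cat; apply: iint_perm => //.
apply: uniq_perm; rewrite ?enum_uniq//.
- rewrite cat_uniq !enum_uniq/= andbT; apply/hasPn => x.
  by rewrite !mem_enum => xB; rewrite (disjointFl dAB).
- by move=> x; rewrite mem_cat !mem_enum inE.
Qed.

Lemma integral_over1 v f : integral_over mu [set v]%SET f =
  (fun w => \int[mu v]_t f (dfwith w v t))%E.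
Proof. by rewrite /integral_over enum_set1. Qed.

Lemma integral_over0 f : integral_over mu finset.set0 f = f.
Proof. by rewrite /integral_over enum_set0. Qed.

(** The comparison is asked only on the fibre through [w], so functions of the coordinates outside
    [s] can be treated as constants. *)
Lemma le_iint s f g w : nn_measurable f -> nn_measurable g ->
  (forall w', (forall v, v \notin s -> w' v = w v) -> (f w' <= g w')%E) ->
  (iint s f w <= iint s g w)%E.
Proof.
move=> nnf nng; elim: s w => [|v s IH] w fg /=; first exact: fg.
have [f0 mf] := nn_measurable_iint s nnf; have [g0 mg] := nn_measurable_iint s nng.
apply: ge0_le_integral => //; [exact: measurable_section..|].
move=> t _; apply: IH => w' ww'; apply: fg => u.
rewrite inE negb_or => /andP[uv us].
by rewrite ww'// dfwithout// eq_sym.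
Qed.

Lemma eq_iint s f g w :
  (forall w', (forall v, v \notin s -> w' v = w v) -> f w' = g w') ->
  iint s f w = iint s g w.
Proof.
elim: s w => [|v s IH] w fg /=; first exact: fg.
apply: eq_integral => t _; apply: IH => w' ww'; apply: fg => u.
rewrite inE negb_or => /andP[uv us].
by rewrite ww'// dfwithout// eq_sym.
Qed.

Lemma iint_depends s f S w w' : depends_only_on S f ->
  (forall v, v \in S -> v \notin s -> w v = w' v) -> iint s f w = iint s f w'.
Proof.
move=> fS; elim: s w w' => [|v s IH] w w' ww' /=.
  by apply: fS => u uS; exact: ww'.
apply: eq_integral => t _; apply: IH => u uS us.
have [<-|ne] := eqVneq v u; first by rewrite !dfwithin.
by rewrite !dfwithout// ww'// inE negb_or eq_sym ne.
Qed.

Lemma iintZ s c f w : nn_measurable f -> 0 <= c ->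
  iint s (fun w => c%:E * f w)%E w = (c%:E * iint s f w)%E.
Proof.
move=> nnf c0; elim: s w => //= v s IH w.
have [g0 mg] := nn_measurable_iint s nnf.
under eq_integral do rewrite IH.
by rewrite ge0_integralZl_EFin//; exact: measurable_section.
Qed.

Lemma iintD s f g w : nn_measurable f -> nn_measurable g ->
  iint s (fun w => f w + g w)%E w = (iint s f w + iint s g w)%E.
Proof.
move=> nnf nng; elim: s w => //= v s IH w.
have [f0 mf] := nn_measurable_iint s nnf; have [g0 mg] := nn_measurable_iint s nng.
under eq_integral do rewrite IH.
by rewrite ge0_integralD//; exact: measurable_section.
Qed.

Lemma nn_measurableZ c f : 0 <= c -> nn_measurable f ->
  nn_measurable (fun w => c%:E * f w)%E.
Proof.
by move=> c0 [f0 mf]; split=> [w|]; [exact: mule_ge0|exact: measurable_funeM].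
Qed.

Lemma nn_measurableD f g : nn_measurable f -> nn_measurable g ->
  nn_measurable (fun w => f w + g w)%E.
Proof.
by move=> [f0 mf] [g0 mg]; split=> [w|]; [exact: adde_ge0|exact: emeasurable_funD].
Qed.

Lemma iint_lt_pinfty s f : nn_measurable f -> uniq s ->
  (forall S w, integral_over mu S f w < +oo)%E -> forall w, (iint s f w < +oo)%E.
Proof.
move=> nnf us foo w; have := foo [set v in s]%SET w; rewrite /integral_over.
rewrite -/(iint _ f) (@iint_perm _ s)//.
apply: uniq_perm; rewrite ?enum_uniq// => x.
by rewrite mem_enum inE.
Qed.

(* Iterated integrals of signed functions are only linear when every inner
   integral is finite, whence the finiteness of all the marginals. *)
Lemma iintB s (f g : config T -> R) w :
  nn_measurable (EFin \o f) -> nn_measurable (EFin \o g) -> uniq s ->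
  (forall S w, integral_over mu S (EFin \o f) w < +oo)%E ->
  (forall S w, integral_over mu S (EFin \o g) w < +oo)%E ->
  iint s (fun w => (f w - g w)%:E) w = (iint s (EFin \o f) w - iint s (EFin \o g) w)%E.
Proof.
move=> nnf nng us foo goo; elim: s us w => //= v s IH /[dup] uvs /andP[_ us] w.
have [f0 mf] := nn_measurable_iint s nnf; have [g0 mg] := nn_measurable_iint s nng.
have H h : nn_measurable h -> (forall S w, integral_over mu S h w < +oo)%E ->
    (mu v).-integrable setT (fun t => iint s h (dfwith w v t)).
  move=> nnh hoo; have [h0 mh] := nn_measurable_iint s nnh.
  apply/integrableP; split; first exact: measurable_section.
  under eq_integral do rewrite gee0_abs//.
  exact: (@iint_lt_pinfty (v :: s)).
under eq_integral do rewrite IH//.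
by rewrite integralB//; exact: H.
Qed.

End Iint.

(** * Marginals of the mechanism *)

Section Marginals.
Context (R : realType) (n : nat) (d : var n -> measure_display)
  (T : forall v, measurableType (d v))
  (mu : forall v, {sigma_finite_measure set (T v) -> \bar R}).

Notation cfg := (g_sigma_algebraType (@coordinate_sets n d T)).

(** Stated for any [g], because it serves both for the joint density and for the two parts of its
    derivative in the parameter. *)
Definition marg (g : config T -> R) (S : {set var n}) (w : config T) : R :=
  fine (integral_over mu (~: S)%SET (EFin \o g) w).

(** Finiteness at every [w], not just almost everywhere, makes [fine] in [marg] lossless. *)
Definition fibrewise_finite (g : config T -> R) :=
  nn_measurable (EFin \o g) /\
  forall S w, (integral_over mu S (EFin \o g) w < +oo)%E.

Section OneDensity.
Context (g : config T -> R) (gf : fibrewise_finite g).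

Lemma margE S w : (marg g S w)%:E = integral_over mu (~: S)%SET (EFin \o g) w.
Proof.
have [nng goo] := gf; rewrite /marg fineK// ge0_fin_numE//.
exact: (nn_measurable_iint mu (enum (~: S)%SET) nng).1.
Qed.

Lemma marg_ge0 S w : 0 <= marg g S w.
Proof.
by rewrite -lee_fin margE; exact: (nn_measurable_iint mu (enum (~: S)%SET) gf.1).1.
Qed.

Lemma nn_measurable_marg S : nn_measurable (EFin \o marg g S).
Proof.
have -> : EFin \o marg g S = integral_over mu (~: S)%SET (EFin \o g).
  by apply/funext => w; exact: margE.
exact: (nn_measurable_iint mu (enum (~: S)%SET) gf.1).
Qed.

Lemma measurable_marg S : measurable_fun [set: cfg] (marg g S).
Proof. by case: (nn_measurable_marg S) => _ /measurable_EFinP. Qed.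

Lemma marg_depends S : depends_only_on S (marg g S).
Proof.
move=> w w' ww'; congr fine; rewrite /integral_over.
apply: (@iint_depends _ _ _ _ mu _ _ [set: var n]%SET) => [u u' uu'|v _].
  rewrite (_ : u = u')//; apply: (@functional_extensionality_dep _ _ u u') => v.
  by apply: uu'; rewrite inE.
by rewrite mem_enum inE negbK; exact: ww'.
Qed.

(** Tower property: the coordinates outside [S] are those of [U] together with those outside
    [U :|: S]. *)
Lemma integral_marg (U S : {set var n}) w : [disjoint U & S]%B ->
  integral_over mu U (EFin \o marg g (U :|: S)%SET) w = (marg g S w)%:E.
Proof.
move=> dUS; rewrite margE.
have -> : (~: S = U :|: ~: (U :|: S))%SET.
  apply/setP => x; rewrite !inE; have [xU|//] := boolP (x \in U).
  by rewrite (disjointFr dUS).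
have -> : EFin \o marg g (U :|: S)%SET =
    integral_over mu (~: (U :|: S))%SET (EFin \o g).
  by apply/funext => u; exact: margE.
rewrite integral_overU//; first exact: gf.1.
by rewrite finset.setCU -setI_eq0 finset.setIA finset.setICr finset.set0I.
Qed.

End OneDensity.

Lemma iint_factor s (c : config T -> R) f S w : nn_measurable f ->
  (forall w, 0 <= c w) -> depends_only_on S c -> (forall v, v \in S -> v \notin s) ->
  iint mu s (fun w => (c w)%:E * f w)%E w = ((c w)%:E * iint mu s f w)%E.
Proof.
move=> nnf c0 cS Ss; rewrite -iintZ//; apply: eq_iint => w' ww'.
by congr (_%:E * _)%E; apply: cS => v vS; rewrite ww'// Ss.
Qed.

(** * Integrating out the outputs of the mechanism *)

Section Mechanism.
Context (q : 'I_n -> config T -> R).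
Hypothesis q_meas : forall i, config_measurable (q i).
Hypothesis q_ge0 : forall i w, 0 <= q i w.
Hypothesis q_dep : forall i : 'I_n, depends_only_on (inl i |: pastZ n i.+1)%SET (q i).
Hypothesis q_int : forall (i : 'I_n) (w : config T),
  (\int[mu (inr i)]_z (q i (dfwith w (inr i) z))%:E)%E = 1%E.

Context (h : config T -> R).
Hypothesis h_ge0 : forall w, 0 <= h w.
Hypothesis h_dep : depends_only_on (allX n) h.

(** [h] will be the density of the X's or the positive or negative part of its derivative: all three
    are multiplied by the same kernels. *)
Let g w := h w * \prod_(i < n) q i w.
Hypothesis gf : fibrewise_finite g.

Definition futureZ (k : nat) : {set var n} :=
  [set v : var n | if v is inr l then (k <= l)%N else false]%SET.

Lemma futureZS (i : 'I_n) : futureZ i = (inr i |: futureZ i.+1)%SET.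
Proof.
apply/setP => -[l|l]; rewrite !inE/=; first by [].
by rewrite leq_eqVlt eq_sym.
Qed.

(** Downward induction on [k], latest output first: when output [k] is integrated, only [q k] still
    involves it, and [q k] has integral 1. *)
Lemma integral_futureZ k : (k <= n)%N ->
  integral_over mu (futureZ k) (EFin \o g) =
  (fun w => (h w * \prod_(i < n | (i < k)%N) q i w)%:E).
Proof.
move: {2}(n - k)%N (erefl (n - k)%N) => m; elim: m k => [|m IH] k nkm kn.
  have {kn nkm} -> : k = n by apply/eqP; rewrite eqn_leq kn -subn_eq0 nkm.
  have -> : futureZ n = finset.set0.
    by apply/setP => -[l|l]; rewrite !inE//= leqNgt ltn_ord.
  rewrite integral_over0; apply/funext => w; congr (_ * _)%:E.
  by apply: eq_bigl => i; rewrite ltn_ord.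
have kn' : (k < n)%N by rewrite -subn_gt0 nkm.
pose i := Ordinal kn'.
rewrite (futureZS i) integral_overU; last 2 first.
- exact: gf.1.
- by rewrite disjoints1 inE/= ltnn.
rewrite IH// ?subnS ?nkm// integral_over1; apply/funext => w.
transitivity (\int[mu (inr i)]_t ((h w * \prod_(j < n | (j < k)%N) q j w)%:E *
    (q i (dfwith w (inr i) t))%:E))%E.
  apply: eq_integral => t _; rewrite -EFinM -mulrA; congr (_ * _)%:E.
    by apply: h_dep => -[l|l]; rewrite inE// => _; rewrite dfwithout.
  rewrite (bigD1 i)//= mulrC; congr (_ * _); apply: eq_big => [j|j /andP[]].
    by rewrite ltnS [RHS]ltn_neqAle andbC.
  rewrite ltnS => jk ji; have {ji}jk : (j < k)%N by rewrite ltn_neqAle jk andbT.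
  apply: q_dep => v; rewrite !inE => vj; rewrite dfwithout//.
  by apply: contraTneq vj => <- /=; rewrite -leqNgt.
rewrite ge0_integralZl_EFin//.
- by rewrite q_int mule1.
- by move=> t _; rewrite lee_fin.
- apply: (@measurable_section _ _ _ _ (EFin \o q i)).
  by apply/measurable_EFinP; exact: q_meas.
- by rewrite mulr_ge0// prodr_ge0.
Qed.

(** Once the later outputs are gone, both sides are integrals over the X's outside [A], and the
    integrands differ by the factor [q j]. *)
Lemma marg_release (A : {set var n}) (j : 'I_n) w : A \subset allX n -> inl j \in A ->
  marg g (inr j |: (pastZ n j :|: A))%SET w = marg g (pastZ n j :|: A)%SET w * q j w.
Proof.
move=> AX jA; apply: EFin_inj; rewrite EFinM !margE// muleC.
have nng := gf.1.
have step k : (k <= n)%N -> integral_over mu (~: (pastZ n k :|: A))%SET (EFin \o g) =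
    integral_over mu (allX n :\: A)%SET
      (fun w => (h w * \prod_(i < n | (i < k)%N) q i w)%:E).
  move=> kn; rewrite -integral_futureZ// -integral_overU//; last first.
    by rewrite -setI_eq0; apply/eqP/setP => -[l|l]; rewrite !inE ?andbF.
  congr (integral_over mu _ _ ); apply/setP => v.
  have := fintype.subsetP AX v; case: v => l; rewrite !inE/=.
    by rewrite orbF andbT.
  by case: (_ \in A) => [/(_ isT)//|_]; rewrite orbF andbF/= -leqNgt.
have -> : (inr j |: (pastZ n j :|: A) = pastZ n j.+1 :|: A)%SET.
  by apply/setP => -[l|l]; rewrite !inE/= ?orbA// ltnS [in RHS]leq_eqVlt.
rewrite !step//; last exact: ltnW.
(* [q j] involves [inl j], which lies in [A], and outputs up to [j]; none of them is integrated
   here. *)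
rewrite -(@iint_factor _ _ _ (inl j |: pastZ n j.+1)%SET)//; last first.
- move=> -[l|l]; rewrite mem_enum !inE/=; last by rewrite andbF.
  by rewrite orbF => /eqP[->]; rewrite jA.
- rewrite -integral_futureZ; last exact: ltnW.
  exact: (nn_measurable_iint mu (enum _)).
apply: eq_iint => w' _ ; rewrite -EFinM; congr EFin.
rewrite mulrCA; congr (_ * _).
rewrite (bigD1 j)//=; congr (_ * _); apply: eq_bigl => i.
by rewrite ltnS [RHS]ltn_neqAle andbC.
Qed.

End Mechanism.
End Marginals.

(** * Weighted square integrals over one coordinate *)

Lemma measurable_funV_ge0 d (X : measurableType d) (R : realType) (f : X -> R) :
  measurable_fun setT f -> (forall x, 0 <= f x) ->
  measurable_fun setT (fun x => (f x)^-1).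
Proof.
move=> mf f0; apply: (@eq_measurable_fun _ _ _ _ setT (fun x => powR (f x) (-1))).
  by move=> x _; rewrite powR_inv1.
by apply: (measurableT_comp (f := fun y => powR y (-1))) => //; exact: measurable_powR.
Qed.

Section OneFibre.
Context d (X : measurableType d) (R : realType) (m : {measure set X -> \bar R}).

Notation rint f := (m.-integrable setT (EFin \o f)).

Lemma rintZ (c : R) (f : X -> R) : rint f -> rint (fun x => c * f x).
Proof. by move=> /(integrableZl measurableT c). Qed.

Lemma rintD (f g : X -> R) : rint f -> rint g -> rint (fun x => f x + g x).
Proof. exact: integrableD. Qed.

Lemma rintB (f g : X -> R) : rint f -> rint g -> rint (fun x => f x - g x).
Proof. exact: integrableB. Qed.

Lemma rint_norm (f : X -> R) : rint f -> rint (fun x => `|f x|).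
Proof. exact: integrable_norm. Qed.

Lemma rint_measurable (f : X -> R) : rint f -> measurable_fun setT f.
Proof. by move=> /measurable_int/measurable_EFinP. Qed.

Lemma rintM_bounded (f k : X -> R) (M : R) : rint f -> measurable_fun setT k ->
  (forall x, 0 <= k x <= M) -> rint (fun x => f x * k x).
Proof.
move=> rf mk k0M.
apply: (le_integrable measurableT _ _ (rintZ M (rint_norm rf))).
  apply/measurable_EFinP; apply: measurable_funM => //.
  exact: rint_measurable.
move=> x _; have /andP[k0 kM] := k0M x.
rewrite /= lee_fin normrM (ger0_norm k0) mulrC normrM normr_id.
by apply: ler_wpM2r => //; rewrite (le_trans kM)// ler_norm.
Qed.

Lemma EFin_Rintegral (f : X -> R) : rint f ->
  (\int[m]_x f x)%:E = (\int[m]_x (f x)%:E)%E.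
Proof. by move=> rf; rewrite /Rintegral fineK//; exact: integrable_fin_num. Qed.

Lemma chi2_measurable (a l : X -> R) : rint a -> rint l -> (forall x, 0 <= l x) ->
  measurable_fun setT (fun x => a x ^+ 2 / l x).
Proof.
move=> ra rl l0; apply: measurable_funM.
  by apply: measurable_funX; exact: rint_measurable.
by apply: measurable_funV_ge0 => //; exact: rint_measurable.
Qed.

Lemma chi2_ge0 (a l : X -> R) x : (forall x, 0 <= l x) -> 0 <= a x ^+ 2 / l x.
Proof. by move=> l0; rewrite mulr_ge0 ?sqr_ge0// invr_ge0. Qed.

Section Densities.
Context (l : X -> R) (rl : rint l).
Hypothesis l_ge0 : forall x, 0 <= l x.
Hypothesis l_gt0 : 0 < \int[m]_x l x.

Lemma chi2_finite (a : X -> R) : rint a ->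
  (\int[m]_x (a x ^+ 2 / l x)%:E < +oo)%E -> rint (fun x => a x ^+ 2 / l x).
Proof.
move=> ra aoo; apply/integrableP; split.
  by apply/measurable_EFinP/chi2_measurable.
by under eq_integral do rewrite /= ger0_norm ?chi2_ge0//.
Qed.

(** Cauchy-Schwarz with weight [l]. Where [l] vanishes the quotient takes the default value 0, hence
    the condition that [a] vanishes there too. *)
Lemma chi2_norm1 (a : X -> R) : rint a -> (forall x, l x = 0 -> a x = 0) ->
  (((\int[m]_x `|a x|) ^+ 2 / \int[m]_x l x)%:E <= \int[m]_x (a x ^+ 2 / l x)%:E)%E.
Proof.
move=> ra la; have [->|aoo] := eqVneq (\int[m]_x (a x ^+ 2 / l x)%:E)%E +oo%E.
  exact: leey.
have rc : rint (fun x => a x ^+ 2 / l x) by apply: chi2_finite => //; rewrite ltey.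
rewrite -EFin_Rintegral// lee_fin.
set B := \int[m]_x `|a x|; set L := \int[m]_x l x; set c := (X in _ <= X).
(* This [t] maximizes [2 * t * B - t ^+ 2 * L], with maximum [B ^+ 2 / L]. *)
pose t := B / L.
(* AM-GM: [2 t |a| <= t^2 l + a^2 / l] *)
have : 2 * t * B <= t ^+ 2 * L + c.
  rewrite -(RintegralZl _ measurableT (rint_norm ra)).
  rewrite -(RintegralZl _ measurableT rl) -RintegralD//; last exact: rintZ.
  apply: le_Rintegral => //; [exact/rintZ/rint_norm|exact/rintD/rc/rintZ|].
  move=> x _; have [lx0|lx0] := eqVneq (l x) 0.
    by rewrite la// lx0 normr0 expr0n !(mulr0, mul0r) addr0.
  rewrite -subr_ge0 -[a x ^+ 2]real_normK ?num_real//.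
  have -> : t ^+ 2 * l x + `|a x| ^+ 2 / l x - 2 * t * `|a x| =
      (t * l x - `|a x|) ^+ 2 / l x by field.
  exact: (chi2_ge0 (fun x => t * l x - `|a x|)).
have -> : 2 * t * B = 2 * (B ^+ 2 / L) by rewrite /t; field; rewrite gt_eqF.
have -> : t ^+ 2 * L = B ^+ 2 / L by rewrite /t; field; rewrite gt_eqF.
lra.
Qed.

(** The kernel estimate for one fixed output: [l] is the density of the private variable, [a] its
    centred derivative, [k] the kernel as a function of the input, and [e] will be [expR alpha]. *)
Lemma chi2_private (a k : X -> R) (e eps : R) : rint a ->
  (forall x, l x = 0 -> a x = 0) -> measurable_fun setT k ->
  (forall x, 0 <= k x) -> 1 <= e -> (forall x x', k x <= e * k x') -> 0 < eps ->
  (((\int[m]_x (a x * k x)) ^+ 2 / \int[m]_x (l x * k x))%:E <=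
   ((\int[m]_x (l x * k x)) / \int[m]_x l x)%:E *
   (((1 + eps^-1) * (e - 1) ^+ 2)%:E * \int[m]_x (a x ^+ 2 / l x)%:E +
    ((1 + eps) * ((\int[m]_x a x) ^+ 2 / \int[m]_x l x))%:E))%E.
Proof.
move=> ra la mk k0 e1 ke eps0.
pose x0 : X := point.
have kb x : 0 <= k x <= e * k x0 by rewrite k0 ke.
have rlk := rintM_bounded rl mk kb; have rak := rintM_bounded ra mk kb.
set L := \int[m]_x l x; set N := \int[m]_x (l x * k x).
set kappa := N / L.
set M := \int[m]_x (a x * k x); set A := \int[m]_x a x.
set chi := (\int[m]_x (a x ^+ 2 / l x)%:E)%E.
pose B := \int[m]_x `|a x|.
have L0 : L != 0 by rewrite gt_eqF.
have NE : N = kappa * L by rewrite /kappa; field.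
(* [kappa] is the [l]-average of [k], so averaging the privacy inequality over one of its two inputs
   gives this bound and the next. *)
have kappa_ge x : k x <= e * kappa.
  rewrite /kappa mulrA ler_pdivlMr// /N -(RintegralZl _ measurableT rlk).
  rewrite -(RintegralZl _ measurableT rl); apply: le_Rintegral => //.
  - exact: rintZ.
  - exact: rintZ.
  - by move=> y _; rewrite mulrCA mulrC; apply: ler_wpM2l.
have kappa_le x : kappa <= e * k x.
  rewrite /kappa ler_pdivrMr// /N -(RintegralZl _ measurableT rl).
  apply: le_Rintegral => //; first exact: rintZ.
  by move=> y _; rewrite mulrC; apply: ler_wpM2r.
have kappa0 : 0 <= kappa.
  by rewrite /kappa divr_ge0 ?(ltW l_gt0)// Rintegral_ge0// => x _; rewrite mulr_ge0.
have dev x : `|k x - kappa| <= (e - 1) * kappa.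
  rewrite ler_norml; apply/andP; split; last by have := kappa_ge x; lra.
  have := kappa_le x; have := k0 x => kx0 kx1.
  (* Since [1 - (e - 1) ^+ 2 = e * (2 - e)], this is [e] times the wanted
     [(2 - e) * kappa <= k x]. *)
  have : kappa <= e * k x + (e - 1) ^+ 2 * kappa.
    by rewrite (le_trans kx1)// lerDl mulr_ge0 ?sqr_ge0.
  nra.
clearbody kappa.
have rka : rint (fun x => kappa * a x) by exact: rintZ.
have MA : `|M - kappa * A| <= (e - 1) * kappa * B.
  rewrite /M /A -(RintegralZl _ measurableT ra) -RintegralB//.
  apply: (le_trans (le_normr_Rintegral _ _)) => //; first exact: rintB.
  rewrite -(RintegralZl _ measurableT (rint_norm ra)); apply: le_Rintegral => //.
  - exact/rint_norm/rintB.
  - exact/rintZ/rint_norm.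
  move=> x _; rewrite [kappa * _]mulrC -mulrBr normrM mulrC.
  by apply: ler_wpM2r.
have step : M ^+ 2 / N <= kappa *
    ((1 + eps^-1) * (e - 1) ^+ 2 * (B ^+ 2 / L) + (1 + eps) * (A ^+ 2 / L)).
  (* If [kappa = 0] then [N = 0], and both sides are 0 because the inverse of 0 is 0. *)
  have [kz|kz] := eqVneq kappa 0.
    by rewrite NE kz !mul0r invr0 mulr0.
  have kp : 0 < kappa by rewrite lt_def kz.
  rewrite NE ler_pdivrMr ?mulr_gt0//.
  have -> : kappa * ((1 + eps^-1) * (e - 1) ^+ 2 * (B ^+ 2 / L) +
      (1 + eps) * (A ^+ 2 / L)) * (kappa * L) =
     (1 + eps^-1) * ((e - 1) * kappa * B) ^+ 2 + (1 + eps) * (kappa * A) ^+ 2.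
    by field; rewrite L0 gt_eqF.
  (* Young's inequality for the square of [M = (M - kappa * A) + kappa * A]; the defect is a square
     divided by [eps]. *)
  apply: (@le_trans _ _ ((1 + eps^-1) * (M - kappa * A) ^+ 2 +
                          (1 + eps) * (kappa * A) ^+ 2)).
    rewrite -subr_ge0.
    have -> : (1 + eps^-1) * (M - kappa * A) ^+ 2 + (1 + eps) * (kappa * A) ^+ 2 -
       M ^+ 2 = (M - kappa * A - eps * (kappa * A)) ^+ 2 / eps.
      by field; rewrite gt_eqF.
    by rewrite divr_ge0 ?sqr_ge0// ltW.
  rewrite lerD2r; apply: ler_wpM2l; first by rewrite addr_ge0// invr_ge0 ltW.
  by rewrite -[X in X <= _]real_normK ?num_real// ler_pXn2r// nnegrE (le_trans _ MA).
move: step; rewrite -lee_fin => /le_trans; apply.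
rewrite EFinM EFinD; apply: lee_wpmul2l; first by rewrite lee_fin.
apply: leeD2r; rewrite EFinM; apply: lee_wpmul2l.
  by rewrite lee_fin mulr_ge0 ?sqr_ge0// addr_ge0// invr_ge0 ltW.
exact: chi2_norm1.
Qed.

(** Pythagoras: [b - s * l] has integral 0 for this [s], so moving from [s] to [c] adds
    [(c - s) ^+ 2] times the integral of [l]. *)
Lemma chi2_projection (b : X -> R) (c : R) : rint b -> (forall x, l x = 0 -> b x = 0) ->
  (\int[m]_x ((b x - (\int[m]_x b x) / (\int[m]_x l x) * l x) ^+ 2 / l x)%:E <=
   \int[m]_x ((b x - c * l x) ^+ 2 / l x)%:E)%E.
Proof.
move=> rb lb; set s := _ / _.
have rbc t : rint (fun x => b x - t * l x) by apply: rintB => //; exact: rintZ.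
have [->|coo] := eqVneq (\int[m]_x ((b x - c * l x) ^+ 2 / l x)%:E)%E +oo%E.
  exact: leey.
have rc : rint (fun x => (b x - c * l x) ^+ 2 / l x).
  by apply: chi2_finite => //; rewrite ltey.
have rt : rint (fun x => 2 * (c - s) * b x + (s ^+ 2 - c ^+ 2) * l x).
  by apply: rintD; exact: rintZ.
(* The term [b x ^+ 2 / l x] cancels, so the two integrands differ by an integrable combination of
   [b] and [l]. *)
have sE x : (b x - s * l x) ^+ 2 / l x = (b x - c * l x) ^+ 2 / l x +
    (2 * (c - s) * b x + (s ^+ 2 - c ^+ 2) * l x).
  have [lx0|lx0] := eqVneq (l x) 0; last by field.
  by rewrite lb// lx0 !mulr0 subrr expr0n mul0r !addr0.
rewrite -(EFin_Rintegral rc); under eq_integral do rewrite sE.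
rewrite -EFin_Rintegral; last exact: rintD.
rewrite lee_fin RintegralD// gerDl RintegralD//; [|exact: rintZ..].
rewrite !RintegralZl//.
have -> : \int[m]_x b x = s * \int[m]_x l x by rewrite /s; field; rewrite gt_eqF.
have -> : 2 * (c - s) * (s * \int[m]_x l x) + (s ^+ 2 - c ^+ 2) * \int[m]_x l x =
  - ((c - s) ^+ 2 * \int[m]_x l x) by ring.
by rewrite oppr_le0 mulr_ge0 ?sqr_ge0// ltW.
Qed.

End Densities.
End OneFibre.

(** * Differentiation in the parameter *)

Section OpenParameter.
Context (R : realType) (Theta : set R) (theta : R).
Hypotheses (oTheta : open Theta) (Ttheta : Theta theta).

(** The derivative is the pointwise limit of difference quotients along a sequence of steps tending
    to 0. *)
Lemma measurable_derive1 d (X : measurableType d) (F : R -> X -> R) :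
  (forall t, Theta t -> measurable_fun setT (F t)) ->
  (forall x, derivable (fun t => F t x) theta 1) ->
  measurable_fun setT (fun x => ((fun t => F t x)^`())%classic theta).
Proof.
move=> mF dF.
have [e /= e0 He] : exists2 e : R, 0 < e & ball theta e `<=` Theta.
  have /nbhs_ballP[e e0 He] : nbhs theta Theta by exact: open_nbhs_nbhs.
  by exists e.
(* Positive steps below [e], so that every [u k + theta] stays in [Theta]. *)
pose u k : R := e / 2 * k.+1%:R^-1.
have u0 k : 0 < u k by rewrite mulr_gt0// ?divr_gt0// invr_gt0.
have Tu k : Theta (u k + theta).
  apply: He; rewrite /ball/= opprD addrCA subrr addr0 normrN gtr0_norm//.
  rewrite /u -mulrA gtr_pMr// (@le_lt_trans _ _ 2^-1)//.
    by rewrite ler_piMr// invf_le1// ler1n.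
  by rewrite invf_lt1// ltr1n.
apply: (@measurable_fun_cvg _ _ _ setT
  (fun k x => (u k)^-1 * (F (u k + theta) x - F theta x))).
  move=> k; apply: measurable_funM => //; apply: measurable_funB; exact: mF.
move=> x _; rewrite derive1E.
have /cvgr_dnbhsP/(_ u) := dF x.
have -> : (fun k => (u k)^-1 * (F (u k + theta) x - F theta x)) =
  (fun k => (u k)^-1 *: (((fun t => F t x) \o shift theta) (u k *: 1) - F theta x)).
  by apply/funext => k /=; rewrite [u k *: 1]mulr1.
apply; split; first by move=> k; rewrite gt_eqF.
rewrite -[0](mulr0 (e / 2)); apply: cvgMr; exact: cvg_harmonic.
Qed.

(** A zero of a nonnegative function is an interior minimum. This is why derivatives of densities
    vanish where the densities do. *)
Lemma ge0_derive1_eq0 (f : R -> R) : (forall t, Theta t -> 0 <= f t) ->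
  (forall t, Theta t -> derivable f t 1) -> f theta = 0 -> (f^`())%classic theta = 0.
Proof.
move=> f0 df fz.
have [e /= e0 He] : exists2 e : R, 0 < e & ball theta e `<=` Theta.
  have /nbhs_ballP[e e0 He] : nbhs theta Theta by exact: open_nbhs_nbhs.
  by exists e.
have inT t : t \in `](theta - e), (theta + e)[ -> Theta t.
  rewrite in_itv/= => /andP[t1 t2]; apply: He.
  by rewrite /ball/= ltr_norml; apply/andP; split; lra.
rewrite derive1E.
apply: (@derive_val _ _ _ _ _ f _ (@derive1_at_min _ f (theta - e) (theta + e) theta _ _ _ _)).
- lra.
- by move=> t /inT; exact: df.
- by rewrite in_itv/=; apply/andP; split; lra.
- by move=> t /inT Tt; rewrite fz f0.
Qed.

End OpenParameter.

(** * Conditional information *)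

Section Information.
Context (R : realType) (n : nat) (d : var n -> measure_display)
  (T : forall v, measurableType (d v))
  (mu : forall v, {sigma_finite_measure set (T v) -> \bar R})
  (alpha : R) (Theta : set R)
  (p : R -> config T -> R) (q : 'I_n -> config T -> R).
Hypotheses (alpha_gt0 : 0 < alpha) (oTheta : open Theta)
  (p_density : density_family mu Theta p) (q_ldp : ldp_mechanism mu alpha q)
  (pq_regular : regular mu p q Theta).
Context (theta : R) (Ttheta : Theta theta).

Notation cfg := (g_sigma_algebraType (@coordinate_sets n d T)).
Notation dt f := (((fun t => f t)^`())%classic theta).

Let Q (w : config T) : R := \prod_(i < n) q i w.

Let Q_ge0 w : 0 <= Q w.
Proof. by apply: prodr_ge0 => i _; have [_ -> _ _ _] := q_ldp i. Qed.

Let J t (w : config T) := joint p q t w.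

Lemma joint_ge0 t w : Theta t -> 0 <= J t w.
Proof. by move=> Tt; have [_ p0 _ _] := p_density Tt; exact: mulr_ge0 (p0 w) (Q_ge0 w). Qed.

Lemma joint_measurable t : Theta t -> measurable_fun [set: cfg] (J t).
Proof.
move=> Tt; apply: measurable_funM; first by have [] := p_density Tt.
by apply: measurable_prod => i _; have [] := q_ldp i.
Qed.

Lemma joint_fibrewise_finite t : Theta t -> fibrewise_finite mu (J t).
Proof.
move=> Tt; split=> [|S w].
  split=> [w|]; first by rewrite lee_fin joint_ge0.
  by apply/measurable_EFinP; exact: joint_measurable.
by have [+ _ _ _] := pq_regular Tt (~: S)%SET w; rewrite finset.setCK.
Qed.

Lemma joint_derivable t w : Theta t -> derivable (fun t => J t w) t 1.
Proof.
move=> Tt; have [_ + _ _] := pq_regular Tt [set: var n]%SET w.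
by rewrite /lik finset.setCT /integral_over enum_set0.
Qed.

Let Jdot (w : config T) : R := dt (fun t => J t w).
Let D (w : config T) : R := dt (fun t => p t w).

(** [p t] is a function of the X's only for [t] in [Theta]; openness makes this enough for the
    derivative at [theta]. *)
Lemma p_dot_depends : depends_only_on (allX n) D.
Proof.
move=> w w' ww'; rewrite /D !derive1E; apply: near_eq_derive.
have : nbhs theta Theta by exact: open_nbhs_nbhs.
by apply: filterS => t Tt; have [_ _ + _] := p_density Tt; exact.
Qed.

Lemma joint_dotE w : Jdot w = D w * Q w.
Proof.
(* Differentiability is given for the joint density and reaches [p] by dividing by [Q w]; where
   [Q w = 0] both sides are 0, whatever [D w] is. *)
rewrite /Jdot /D; have [Qz|Qnz] := eqVneq (Q w) 0.
  have -> : (fun t => J t w) = cst 0.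
    by apply/funext => t; rewrite /J /joint -/(Q w) Qz mulr0.
  by rewrite derive1_cst Qz mulr0.
have pE : (fun t => p t w) = (fun t => J t w * (Q w)^-1).
  by apply/funext => t; rewrite /J /joint mulfK.
by rewrite pE (derive1Mr (Q w)^-1 (@joint_derivable theta w Ttheta)) mulfVK.
Qed.

Lemma joint_dot_measurable : measurable_fun [set: cfg] Jdot.
Proof.
apply: (measurable_derive1 oTheta Ttheta); first exact: joint_measurable.
by move=> w; exact: joint_derivable.
Qed.

(** Splitting [D] rather than [Jdot] keeps each part of the form (function of the X's) times [Q],
    nonnegative, as [marg_release] requires. *)
Let Dpos (w : config T) : R := Num.max (D w) 0.
Let Dneg (w : config T) : R := Num.max (- D w) 0.

Let Jpos (w : config T) : R := Dpos w * Q w.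
Let Jneg (w : config T) : R := Dneg w * Q w.

Let JposE w : Jpos w = Num.max (Jdot w) 0.
Proof. by rewrite joint_dotE /Jpos /Dpos maxr_pMl ?Q_ge0// mul0r. Qed.

Let JnegE w : Jneg w = Num.max (- Jdot w) 0.
Proof. by rewrite joint_dotE /Jneg /Dneg maxr_pMl ?Q_ge0// mul0r mulNr. Qed.

Let Jdot_split w : Jdot w = Jpos w - Jneg w.
Proof.
rewrite JposE JnegE; case/orP: (le_total 0 (Jdot w)) => J0.
  by rewrite max_l// max_r ?subr0// oppr_le0.
by rewrite max_r// max_l ?sub0r ?opprK// oppr_ge0.
Qed.

Lemma dominated_fibrewise_finite (g : config T -> R) : measurable_fun [set: cfg] g ->
  (forall w, 0 <= g w <= `|Jdot w|) -> fibrewise_finite mu g.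
Proof.
move=> mg gJ.
have nng : nn_measurable (EFin \o g).
  by split=> [w|]; [rewrite lee_fin; have /andP[] := gJ w|exact/measurable_EFinP].
split=> // S w; have [_ _ + _] := pq_regular Ttheta (~: S)%SET w.
rewrite finset.setCK; apply: le_lt_trans; apply: le_iint => //.
  split=> [w'|]; first by rewrite lee_fin.
  by apply/measurable_EFinP; apply: measurableT_comp => //; exact: joint_dot_measurable.
by move=> w' _; rewrite lee_fin; have /andP[] := gJ w'.
Qed.

Lemma joint_dot_pos_fibrewise_finite : fibrewise_finite mu Jpos.
Proof.
apply: dominated_fibrewise_finite.
  have -> : Jpos = fun w => Num.max (Jdot w) 0 by apply/funext => w; exact: JposE.
  by apply: measurable_maxr => //; exact: joint_dot_measurable.
by move=> w; rewrite JposE le_max lexx orbT/= ge_max ler_norm normr_ge0.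
Qed.

Lemma joint_dot_neg_fibrewise_finite : fibrewise_finite mu Jneg.
Proof.
apply: dominated_fibrewise_finite.
  have -> : Jneg = fun w => Num.max (- Jdot w) 0 by apply/funext => w; exact: JnegE.
  by apply: measurable_maxr => //; apply: measurable_funN; exact: joint_dot_measurable.
by move=> w; rewrite JnegE le_max lexx orbT/= ge_max -normrN ler_norm normr_ge0.
Qed.

Let Jff := joint_fibrewise_finite Ttheta.
Let pff := joint_dot_pos_fibrewise_finite.
Let nff := joint_dot_neg_fibrewise_finite.

Definition dens (S : {set var n}) (w : config T) : R := marg mu (J theta) S w.
(** This is the derivative of the marginal density ([lik_derive1]), in a form to which the facts on
    nonnegative marginals apply. *)
Definition dens_dot (S : {set var n}) (w : config T) : R := marg mu Jpos S w - marg mu Jneg S w.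

Lemma likE S w : lik mu p q S theta w = dens S w. Proof. by []. Qed.

Lemma lik_derive1 S w : dt (fun t => lik mu p q S t w) = dens_dot S w.
Proof.
apply: EFin_inj; have [_ _ _ ->] := pq_regular Ttheta S w.
rewrite EFinB !margE//.
rewrite /integral_over -(iintB _ pff.1 nff.1 (enum_uniq _) pff.2 nff.2).
by apply: eq_iint => w' _; rewrite -Jdot_split.
Qed.

Lemma dens_ge0 S w : 0 <= dens S w.
Proof. exact: marg_ge0. Qed.

Lemma dens_dot_eq0 S w : dens S w = 0 -> dens_dot S w = 0.
Proof.
move=> Lz; rewrite -lik_derive1; apply: (ge0_derive1_eq0 oTheta Ttheta) => // t Tt.
  exact: (marg_ge0 (joint_fibrewise_finite Tt)).
by have [] := pq_regular Tt S w.
Qed.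

Lemma dens_measurable S : measurable_fun [set: cfg] (dens S).
Proof. exact: measurable_marg. Qed.

Lemma dens_dot_measurable S : measurable_fun [set: cfg] (dens_dot S).
Proof. by apply: measurable_funB; exact: measurable_marg. Qed.

Lemma dens_depends (S : {set var n}) (w w' : config T) :
  (forall v, v \in S -> w v = w' v) -> dens S w = dens S w'.
Proof. by move=> ww'; apply: marg_depends. Qed.

Lemma dens_dot_depends (S : {set var n}) (w w' : config T) :
  (forall v, v \in S -> w v = w' v) -> dens_dot S w = dens_dot S w'.
Proof. by move=> ww'; congr (_ - _); apply: marg_depends. Qed.

(** * Integrating one variable out of a marginal *)

Section Integrate.
Context (v : var n) (S : {set var n}) (vS : v \notin S) (w : config T).
Notation rint f := ((mu v).-integrable setT (EFin \o f)).

Lemma marg_section (g : config T -> R) : fibrewise_finite mu g ->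
  rint (fun t => marg mu g (v |: S)%SET (dfwith w v t)) /\
  \int[mu v]_t marg mu g (v |: S)%SET (dfwith w v t) = marg mu g S w.
Proof.
move=> gff; have := integral_marg gff (U := [set v]%SET) (S := S) w.
rewrite disjoints1 => /(_ vS); rewrite integral_over1 => intE.
split; last by rewrite /Rintegral [X in fine X]intE.
apply/integrableP; split.
  apply: (@measurable_section _ _ _ _ (EFin \o marg mu g (v |: S)%SET)).
  exact: (nn_measurable_marg gff _).2.
under eq_integral do rewrite /= ger0_norm ?marg_ge0//.
by rewrite [X in (X < _)%E]intE ltry.
Qed.

Lemma dens_integrable : rint (fun t => dens (v |: S)%SET (dfwith w v t)).
Proof. exact: (marg_section Jff).1. Qed.

Lemma dens_integral : \int[mu v]_t dens (v |: S)%SET (dfwith w v t) = dens S w.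
Proof. exact: (marg_section Jff).2. Qed.

Lemma dens_dot_integrable : rint (fun t => dens_dot (v |: S)%SET (dfwith w v t)).
Proof. by apply: rintB; [exact: (marg_section pff).1|exact: (marg_section nff).1]. Qed.

Lemma dens_dot_integral : \int[mu v]_t dens_dot (v |: S)%SET (dfwith w v t) = dens_dot S w.
Proof.
have [rp Ip] := marg_section pff; have [rn In] := marg_section nff.
by rewrite RintegralB// Ip In.
Qed.

End Integrate.

(** * Factorization of densities and derivatives at a release *)

Section Release.
Context (A : {set var n}) (j : 'I_n) (AX : A \subset allX n) (jA : inl j \in A).
Let S := (pastZ n j :|: A)%SET.

Let release (h : config T -> R) : (forall w, 0 <= h w) ->
  depends_only_on (allX n) h -> fibrewise_finite mu (fun w => h w * Q w) ->
  forall w, marg mu (fun w => h w * Q w) (inr j |: S)%SET w =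
            marg mu (fun w => h w * Q w) S w * q j w.
Proof.
move=> h0 hX hff w; apply: marg_release => // i; by have [] := q_ldp i.
Qed.

Lemma dens_release w : dens (inr j |: S)%SET w = dens S w * q j w.
Proof. by have [_ ? ? _] := p_density Ttheta; exact: release. Qed.

Lemma dens_dot_release w : dens_dot (inr j |: S)%SET w = dens_dot S w * q j w.
Proof.
rewrite /dens_dot mulrBl; congr (_ - _); apply: release => //.
- by move=> u; rewrite le_max lexx orbT.
- by move=> u u' uu'; rewrite /Dpos (@p_dot_depends u u' uu').
- by move=> u; rewrite le_max lexx orbT.
- by move=> u u' uu'; rewrite /Dneg (@p_dot_depends u u' uu').
Qed.

End Release.

(* Nothing is lost through [x / 0 = 0]: [dens_dot] vanishes with [dens]. *)
Definition score_gap (s : R) (S : {set var n}) w : R :=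
  (dens_dot S w - s * dens S w) ^+ 2 / dens S w.

Lemma score_gap_ge0 s S w : 0 <= score_gap s S w.
Proof. by rewrite mulr_ge0 ?sqr_ge0// invr_ge0 dens_ge0. Qed.

Lemma score_gap_measurable (s : config T -> R) S : measurable_fun [set: cfg] s ->
  measurable_fun [set: cfg] (fun w => score_gap (s w) S w).
Proof.
move=> ms; apply: measurable_funM; last first.
  by apply: measurable_funV_ge0; [exact: dens_measurable|exact: dens_ge0].
apply: measurable_funX; apply: measurable_funB; first exact: dens_dot_measurable.
by apply: measurable_funM => //; exact: dens_measurable.
Qed.

Lemma score_gap_nn_measurable s S : nn_measurable (fun w => (score_gap s S w)%:E).
Proof.
split=> [w|]; first by rewrite lee_fin score_gap_ge0.
by apply/measurable_EFinP; exact: score_gap_measurable.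
Qed.

Definition score (S : {set var n}) w := dens_dot S w / dens S w.

Lemma score_depends (S : {set var n}) (w w' : config T) : (forall v, v \in S -> w v = w' v) ->
  score S w = score S w'.
Proof. by move=> ww'; rewrite /score (dens_depends ww') (dens_dot_depends ww'). Qed.

Lemma score_measurable S : measurable_fun [set: cfg] (score S).
Proof.
apply: measurable_funM; first exact: dens_dot_measurable.
by apply: measurable_funV_ge0; [exact: dens_measurable|exact: dens_ge0].
Qed.

(** * The score gap across one private release *)

Section Privacy.
Context (A : {set var n}) (j : 'I_n) (AX : A \subset allX n) (jA : inl j \notin A).
Let S := (pastZ n j :|: A)%SET.
Let X : var n := inl j.
Let Z : var n := inr j.

Let XS : X \notin S. Proof. by rewrite !inE/= jA. Qed.

Let ZS : Z \notin S.
Proof.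
rewrite !inE/= ltnn/=; apply/negP => ZA.
by have := fintype.subsetP AX _ ZA; rewrite inE.
Qed.

Let k (w : config T) (z : T Z) (x : T X) : R := q j (dfwith (dfwith w Z z) X x).

Let k_ge0 (w : config T) z x : 0 <= k w z x.
Proof. by have [_ -> _ _ _] := q_ldp j. Qed.

Let k_ldp (w : config T) z x x' : k w z x <= expR alpha * k w z x'.
Proof. by have [_ _ _ _ ->] := q_ldp j. Qed.

Let k_measurable (w : config T) z : measurable_fun setT (k w z).
Proof.
have [mq _ _ _ _] := q_ldp j.
apply/measurable_EFinP; apply: (@measurable_section _ _ _ _ (EFin \o q j)).
exact/measurable_EFinP.
Qed.

Let expR_ge1 : 1 <= expR alpha.
Proof. by rewrite -expR0 ler_expR ltW. Qed.

Let XAX : (X |: A)%SET \subset allX n.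
Proof. by rewrite finset.subUset finset.sub1set inE AX. Qed.

Let SXE : (X |: S = pastZ n j :|: (X |: A))%SET.
Proof. by rewrite finset.setUCA. Qed.

Let outZ (w : config T) (z : T Z) (x : T X) v : v \in (X |: S)%SET ->
  dfwith (dfwith w Z z) X x v = dfwith w X x v.
Proof.
move=> vXS; have [<-|Xv] := eqVneq X v; first by rewrite !dfwithin.
rewrite [LHS]dfwithout// [RHS]dfwithout// dfwithout//.
by apply: contraTneq vXS => <-; rewrite in_setU1 negb_or ZS andbT.
Qed.

(** Insert [X] by marginalization, then split off the kernel with [dens_release]; the remaining
    density does not see [z]. *)
Lemma dens_mixture (w : config T) (z : T Z) : dens (Z |: S)%SET (dfwith w Z z) =
  \int[mu X]_x (dens (X |: S)%SET (dfwith w X x) * k w z x).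
Proof.
rewrite -(@dens_integral X); last by rewrite in_setU1 negb_or XS andbT.
apply: eq_Rintegral => x _; rewrite finset.setUCA SXE dens_release//; last first.
  by rewrite finset.setU11.
by rewrite -SXE (dens_depends (outZ w z x)).
Qed.

Lemma dens_dot_mixture (w : config T) (z : T Z) : dens_dot (Z |: S)%SET (dfwith w Z z) =
  \int[mu X]_x (dens_dot (X |: S)%SET (dfwith w X x) * k w z x).
Proof.
rewrite -(@dens_dot_integral X); last by rewrite in_setU1 negb_or XS andbT.
apply: eq_Rintegral => x _; rewrite finset.setUCA SXE dens_dot_release//; last first.
  by rewrite finset.setU11.
by rewrite -SXE (dens_dot_depends (outZ w z x)).
Qed.

Let kb (w : config T) (z : T Z) (x : T X) : 0 <= k w z x <= expR alpha * k w z point.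
Proof. by rewrite k_ge0 k_ldp. Qed.

Let Lk_integrable (w : config T) (z : T Z) : (mu X).-integrable setT
  (EFin \o (fun x => dens (X |: S)%SET (dfwith w X x) * k w z x)).
Proof. by apply: rintM_bounded (kb w z) => //; exact: dens_integrable. Qed.

Let Ldk_integrable (w : config T) (z : T Z) : (mu X).-integrable setT
  (EFin \o (fun x => dens_dot (X |: S)%SET (dfwith w X x) * k w z x)).
Proof. by apply: rintM_bounded (kb w z) => //; exact: dens_dot_integrable. Qed.

(** Privacy bounds the kernel uniformly in the input, so the mixture is at most a constant times
    [dens S w], for every [z]. *)
Lemma dens_mixture_eq0 (w : config T) (z : T Z) :
  dens S w = 0 -> dens (Z |: S)%SET (dfwith w Z z) = 0.
Proof.
move=> Lz; apply/eqP; rewrite eq_le dens_ge0 andbT dens_mixture.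
have -> : 0 = expR alpha * k w z point * dens S w by rewrite Lz mulr0.
rewrite -(@dens_integral X S XS w).
rewrite -(RintegralZl _ measurableT (dens_integrable XS w)).
apply: le_Rintegral => //; first exact/rintZ/dens_integrable.
by move=> x _; rewrite mulrC; apply: ler_wpM2r; [exact: dens_ge0|exact: k_ldp].
Qed.

Lemma score_gap_privacy s eps (w : config T) : 0 < eps ->
  (\int[mu Z]_z (score_gap s (Z |: S)%SET (dfwith w Z z))%:E <=
   ((1 + eps^-1) * (expR alpha - 1) ^+ 2)%:E *
     \int[mu X]_x (score_gap s (X |: S)%SET (dfwith w X x))%:E +
   (1 + eps)%:E * (score_gap s S w)%:E)%E.
Proof.
move=> eps0.
have c0 : 0 <= (1 + eps^-1) * (expR alpha - 1) ^+ 2.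
  by rewrite mulr_ge0 ?sqr_ge0// addr_ge0// invr_ge0 ltW.
have i0 : (0 <= \int[mu X]_x (score_gap s (X |: S)%SET (dfwith w X x))%:E)%E.
  by apply: integral_ge0 => x _; rewrite lee_fin score_gap_ge0.
have K0 : (0 <= ((1 + eps^-1) * (expR alpha - 1) ^+ 2)%:E *
     \int[mu X]_x (score_gap s (X |: S)%SET (dfwith w X x))%:E +
   (1 + eps)%:E * (score_gap s S w)%:E)%E.
  by rewrite adde_ge0// ?mule_ge0// lee_fin ?score_gap_ge0// addr_ge0// ltW.
have [Lz|Lnz] := eqVneq (dens S w) 0.
  rewrite integral0_eq// => z _.
  by rewrite /score_gap dens_mixture_eq0// invr0 mulr0.
have Lgt0 : 0 < dens S w by rewrite lt_def Lnz dens_ge0.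
set K := (X in (_ <= X)%E) in K0 *.
(* [chi2_private] for fixed [z]. The bound [K] is free of [z], and its coefficient is the
   conditional density of the output, which integrates to 1. *)
have kap z : ((score_gap s (Z |: S)%SET (dfwith w Z z))%:E <=
    (dens (Z |: S)%SET (dfwith w Z z) / dens S w)%:E * K)%E.
  pose l x := dens (X |: S)%SET (dfwith w X x).
  pose a x := dens_dot (X |: S)%SET (dfwith w X x) - s * l x.
  have rl := dens_integrable XS w.
  have ra : (mu X).-integrable setT (EFin \o a).
    by apply: rintB; [exact: dens_dot_integrable|exact/rintZ].
  have Ll : \int[mu X]_x l x = dens S w by exact: dens_integral.
  have La : \int[mu X]_x a x = dens_dot S w - s * dens S w.
    rewrite RintegralB//; [|exact: dens_dot_integrable|exact/rintZ].
    by rewrite RintegralZl// dens_dot_integral// Ll.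
  have Lak : \int[mu X]_x (a x * k w z x) =
      dens_dot (Z |: S)%SET (dfwith w Z z) - s * dens (Z |: S)%SET (dfwith w Z z).
    rewrite dens_mixture dens_dot_mixture -RintegralZl// -RintegralB//; last exact/rintZ.
    by apply: eq_Rintegral => x _; rewrite /a mulrBl mulrA.
  have := @chi2_private _ _ _ (mu X) l rl _ _ a (k w z) (expR alpha) eps ra.
  rewrite Ll La Lak -dens_mixture; apply => //.
  - by move=> x; exact: dens_ge0.
  - by move=> x lx0; rewrite /a lx0 mulr0 subr0 dens_dot_eq0.
have mH := (@measurable_section _ _ _ _ _ w Z (score_gap_nn_measurable s (Z |: S)%SET).2).
have mL : measurable_fun setT
    (fun z => (dens (Z |: S)%SET (dfwith w Z z) / dens S w)%:E).
  apply: (@measurable_section _ _ _ _ (fun u => (dens (Z |: S)%SET u / dens S w)%:E)).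
  by apply/measurable_EFinP/measurable_funM => //; exact: dens_measurable.
have L0 z : (0 <= (dens (Z |: S)%SET (dfwith w Z z) / dens S w)%:E)%E.
  by rewrite lee_fin divr_ge0// dens_ge0.
apply: (@le_trans _ _ (\int[mu Z]_z
    ((dens (Z |: S)%SET (dfwith w Z z) / dens S w)%:E * K))%E).
  apply: ge0_le_integral => //.
  - by move=> z _; rewrite lee_fin score_gap_ge0.
  - by apply: emeasurable_funM => //; exact: measurable_cst.
under eq_integral do rewrite muleC.
rewrite ge0_integralZl//.
have rLS : (mu Z).-integrable setT
    (EFin \o (fun z => (dens S w)^-1 * dens (Z |: S)%SET (dfwith w Z z))).
  by apply: rintZ; exact: dens_integrable.
under eq_integral do rewrite mulrC.
rewrite -EFin_Rintegral// RintegralZl//; last exact: dens_integrable.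
by rewrite dens_integral// mulVf// mule1.
Qed.

End Privacy.

(** * Conditional Fisher information as an integral of score gaps *)

Lemma cond_lik_dotE (U V : {set var n}) (w : config T) : dens V w != 0 ->
  cond_lik_dot mu p q U V theta w =
  (dens_dot (U :|: V)%SET w - score V w * dens (U :|: V)%SET w) / dens V w.
Proof.
move=> Lnz; rewrite /cond_lik_dot /cond_lik derive1E.
have [_ dUV _ _] := pq_regular Ttheta (U :|: V)%SET w.
have [_ dV _ _] := pq_regular Ttheta V w.
rewrite (deriveM (f := fun t => lik mu p q (U :|: V)%SET t w) dUV); last first.
  exact: (derivableV (f := fun t => lik mu p q V t w)).
rewrite (deriveV (f := fun t => lik mu p q V t w))//.
rewrite -!derive1E !lik_derive1.
rewrite !likE /score /GRing.scale/=.
by field.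
Qed.

(* The fibre [dens V = 0] is discarded by hand: there [score V] is the junk
   value 0, while [fisher] multiplies by [dens V]. *)
Definition fibre_info (U V : {set var n}) (w : config T) : \bar R :=
  if dens V w == 0 then 0%E else
  integral_over mu U (fun u => (score_gap (score V w) (U :|: V)%SET u)%:E) w.

Lemma fisherE (U V : {set var n}) : [disjoint U & V]%B ->
  fisher mu p q theta U V = integral_over mu V (fibre_info U V) point.
Proof.
move=> dUV; rewrite /fisher; congr (integral_over mu V _ _); apply/funext => v.
rewrite /fibre_info likE; case: ifPn => [/eqP->|Lnz]; first by rewrite mul0e.
(* The squared derivative carries [dens V] to the power -2 and the conditional density gives one
   power back; the remaining inverse cancels the weight. *)
have -> : integral_over mu U (fun w => (cond_lik_dot mu p q U V theta w ^+ 2 /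
      cond_lik mu p q U V theta w)%:E) v =
    integral_over mu U (fun w => ((dens V v)^-1)%:E *
      (score_gap (score V v) (U :|: V)%SET w)%:E)%E v.
  apply: eq_iint => w wv.
  have VE u : u \in V -> w u = v u.
    by move=> uV; apply: wv; rewrite mem_enum (disjointFl dUV).
  have Lw : dens V w != 0 by rewrite (dens_depends VE).
  rewrite cond_lik_dotE// (score_depends VE) /cond_lik !likE.
  rewrite (dens_depends VE) /score_gap -EFinM; congr EFin.
  have [->|Lu] := eqVneq (dens (U :|: V)%SET w) 0; last by field; rewrite ?Lnz ?Lu.
  by rewrite mul0r invr0 !mulr0.
rewrite /integral_over -/(iint _ _ _) iintZ//; last by rewrite invr_ge0 dens_ge0.
  by rewrite muleA -EFinM mulfV// mul1e.
exact: score_gap_nn_measurable.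
Qed.

Lemma fibre_info_nn_measurable (U V : {set var n}) : [disjoint U & V]%B ->
  nn_measurable (fibre_info U V).
Proof.
move=> dUV.
(* [dens V w / dens V w] is the indicator of [dens V w != 0]; it turns the case distinction into a
   measurable factor. *)
have -> : fibre_info U V = integral_over mu U
    (fun w => (dens V w / dens V w * score_gap (score V w) (U :|: V)%SET w)%:E).
  apply/funext => v; rewrite /fibre_info.
  have VE w : (forall u, u \notin enum U -> w u = v u) ->
      forall u, u \in V -> w u = v u.
    by move=> wv u uV; apply: wv; rewrite mem_enum (disjointFl dUV).
  case: ifPn => [/eqP Lz|Lnz]; last first.
    apply: eq_iint => w /VE wv.
    by rewrite (dens_depends wv) (score_depends wv) mulfV// mul1r.
  transitivity (integral_over mu U (fun=> 0%E) v).
    by rewrite /integral_over; elim: (enum U) v {Lz VE} => //= u s IH v;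
      rewrite integral0_eq.
  by apply: eq_iint => w /VE wv; rewrite (dens_depends wv) Lz !mul0r.
apply: nn_measurable_iint; split=> [w|].
  by rewrite lee_fin mulr_ge0 ?score_gap_ge0// divr_ge0 ?dens_ge0.
apply/measurable_EFinP/measurable_funM; last first.
  by apply: score_gap_measurable; exact: score_measurable.
apply: measurable_funM; first exact: dens_measurable.
by apply: measurable_funV_ge0; [exact: dens_measurable|exact: dens_ge0].
Qed.

Lemma score_gap_score (S : {set var n}) (w : config T) : score_gap (score S w) S w = 0.
Proof.
rewrite /score_gap /score; have [->|Lnz] := eqVneq (dens S w) 0; first by rewrite invr0 mulr0.
by rewrite mulfVK// subrr expr0n mul0r.
Qed.

Lemma fisher_privatized (i : 'I_n) :
  (fisher mu p q theta [set inr i]%SET (pastZ n i) <=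
   (2 * (expR alpha - 1) ^+ 2)%:E * fisher mu p q theta [set inl i]%SET (pastZ n i))%E.
Proof.
have dZ : [disjoint [set inr i]%SET & pastZ n i]%B.
  by rewrite disjoints1 inE/= ltnn.
have dX : [disjoint [set inl i]%SET & pastZ n i]%B by rewrite disjoints1 inE.
have C0 : 0 <= 2 * (expR alpha - 1) ^+ 2 by rewrite mulr_ge0 ?sqr_ge0.
rewrite !fisherE// /integral_over -/(iint _ _ _).
rewrite -/(iint mu (enum (pastZ n i)) (fibre_info [set inl i]%SET _) _).
rewrite -iintZ//; last exact: fibre_info_nn_measurable.
apply: le_iint; [exact: fibre_info_nn_measurable|
  exact/nn_measurableZ/fibre_info_nn_measurable|].
move=> w _; rewrite /fibre_info; case: ifP => [_|_]; first by rewrite mule0.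
rewrite !integral_over1.
(* The term with [1 + eps] vanishes at the score of [pastZ n i], so any [eps] is allowed; [eps = 1]
   gives the constant 2. *)
have := @score_gap_privacy finset.set0 i (finset.sub0set _) _ (score (pastZ n i) w) 1 w ltr01.
rewrite finset.setU0 score_gap_score mule0 adde0 invr1; apply.
by rewrite inE.
Qed.

(** * Removing the latest output from the conditioning *)

Section Forget.
Context (i j : 'I_n) (ij : i = j.+1 :> nat).
Let X : var n := inl i.
Let Y : var n := inl j.
Let Z : var n := inr j.
Let P := pastZ n j.

Let nij : i != j.
Proof. by apply/eqP => e; move: ij; rewrite e => /eqP; rewrite ltn_eqF. Qed.

Let pastZE : pastZ n i = (Z |: P)%SET.
Proof.
by apply/setP => -[l|l]; rewrite !inE//= ij ltnS leq_eqVlt.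
Qed.

Let XP' : X \notin (Z |: P)%SET. Proof. by rewrite !inE. Qed.

(** The score of [Z |: P] varies with the output; by minimality it can be traded for any [s], in
    particular one that does not. *)
Lemma projected_fibre_info s (w : config T) :
  (fibre_info [set X]%SET (Z |: P)%SET w <=
   \int[mu X]_x (score_gap s (X |: (Z |: P))%SET (dfwith w X x))%:E)%E.
Proof.
rewrite /fibre_info; case: ifPn => [_|Lnz].
  by apply: integral_ge0 => x _; rewrite lee_fin score_gap_ge0.
rewrite integral_over1.
have Lgt0 : 0 < dens (Z |: P)%SET w by rewrite lt_def Lnz dens_ge0.
have := @chi2_projection _ _ _ (mu X)
  (fun x => dens (X |: (Z |: P))%SET (dfwith w X x)) (dens_integrable XP' w) _ _
  (fun x => dens_dot (X |: (Z |: P))%SET (dfwith w X x)) s (dens_dot_integrable XP' w).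
rewrite dens_integral// dens_dot_integral//; apply => //.
- by move=> x; exact: dens_ge0.
- by move=> x; exact: dens_dot_eq0.
Qed.

Lemma fibre_info_forget (eps : R) (w : config T) : 0 < eps ->
  (\int[mu Z]_z fibre_info [set X]%SET (Z |: P)%SET (dfwith w Z z) <=
   ((1 + eps^-1) * (expR alpha - 1) ^+ 2)%:E * fibre_info [set X; Y]%SET P w +
   (1 + eps)%:E * fibre_info [set X]%SET P w)%E.
Proof.
move=> eps0.
have c1 : 0 <= (1 + eps^-1) * (expR alpha - 1) ^+ 2.
  by rewrite mulr_ge0 ?sqr_ge0// addr_ge0// invr_ge0 ltW.
have c2 : 0 <= 1 + eps by rewrite addr_ge0// ltW.
have PS0 : (P :|: finset.set0 = P)%SET by rewrite finset.setU0.
have dXP : [disjoint [set X]%SET & (Z |: P)%SET]%B by rewrite disjoints1.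
rewrite {2 3}/fibre_info; case: ifPn => [/eqP Lz|Lnz].
  rewrite !mule0 adde0 integral0_eq// => z _; rewrite /fibre_info.
  have -> // : dens (Z |: P)%SET (dfwith w Z z) == 0.
  apply/eqP; rewrite -PS0; apply: dens_mixture_eq0; rewrite ?PS0//.
  - exact: finset.sub0set.
  - by rewrite inE.
set s := score P w.
pose S := (P :|: [set X])%SET.
have ZSE : (X |: (Z |: P) = Z |: S)%SET by rewrite /S finset.setUCA (finset.setUC P).
have XYE : ([set X; Y] :|: P = Y |: S)%SET.
  by rewrite /S (finset.setUC [set X]%SET) -finset.setUA (finset.setUC P).
have XE : ([set X] :|: P = S)%SET by rewrite finset.setUC.
have nnZ := nn_measurable_integral mu Z (score_gap_nn_measurable s (Z |: S)%SET).
have nnY := nn_measurable_integral mu Y (score_gap_nn_measurable s (Y |: S)%SET).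
have nnX := score_gap_nn_measurable s S.
(* With [s] free of the output, Tonelli moves the integral over [Z] inside the one over [X], where
   [score_gap_privacy] applies with [A] the singleton of [X]. *)
apply: (@le_trans _ _ (iint mu [:: X]
  (fun u => \int[mu Z]_z (score_gap s (Z |: S)%SET (dfwith u Z z))%:E)%E w)).
  rewrite /= (integral_swap mu X Z w (score_gap_nn_measurable s (Z |: S)%SET)).
  have nnX' := nn_measurable_integral mu X (score_gap_nn_measurable s (Z |: S)%SET).
  have nnI := fibre_info_nn_measurable dXP.
  apply: (@le_iint _ _ _ _ mu [:: Z] _
    (fun u => \int[mu X]_x (score_gap s (Z |: S)%SET (dfwith u X x))%:E)%E) => //.
  by move=> u _; rewrite -ZSE; exact: projected_fibre_info.
rewrite XYE XE integral_overU; last 2 first.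
- exact: score_gap_nn_measurable.
- by rewrite disjoints1 inE.
rewrite !integral_over1.
rewrite -[X in (_ <= _ * X + _)%E]/(iint mu [:: inl i]
  (fun u => \int[mu Y]_y (score_gap s (Y |: S)%SET (dfwith u Y y))%:E)%E w).
rewrite -[X in (_ <= _ + _ * X)%E]/(iint mu [:: inl i] (fun u => (score_gap s S u)%:E) w).
rewrite -iintZ// -iintZ// -iintD; [|exact: nn_measurableZ..].
apply: le_iint => //; first by apply: nn_measurableD; exact: nn_measurableZ.
move=> u _; apply: score_gap_privacy => //.
- by rewrite finset.sub1set inE.
- by rewrite inE; apply: contra nij => /eqP[->].
Qed.

Lemma fisher_forget (eps : R) : 0 < eps ->
  (fisher mu p q theta [set X]%SET (pastZ n i) <=
   ((1 + eps^-1) * (expR alpha - 1) ^+ 2)%:E *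
     fisher mu p q theta [set X; Y]%SET (pastZ n j) +
   (1 + eps)%:E * fisher mu p q theta [set X]%SET (pastZ n j))%E.
Proof.
move=> eps0.
have c1 : 0 <= (1 + eps^-1) * (expR alpha - 1) ^+ 2.
  by rewrite mulr_ge0 ?sqr_ge0// addr_ge0// invr_ge0 ltW.
have c2 : 0 <= 1 + eps by rewrite addr_ge0// ltW.
have dXP' : [disjoint [set X]%SET & (Z |: P)%SET]%B by rewrite disjoints1.
have dXP : [disjoint [set X]%SET & P]%B by rewrite disjoints1 inE.
have dXYP : [disjoint [set X; Y]%SET & P]%B.
  by rewrite -setI_eq0; apply/eqP/setP => -[l|l]; rewrite !inE ?andbF.
have nn1 := fibre_info_nn_measurable dXYP.
have nn2 := fibre_info_nn_measurable dXP.
have nn3 := fibre_info_nn_measurable dXP'.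
rewrite pastZE !fisherE//.
rewrite (finset.setUC [set Z]%SET P) integral_overU; last 2 first.
- by rewrite finset.setUC.
- by rewrite disjoint_sym disjoints1 inE/= ltnn.
rewrite (finset.setUC P [set Z]%SET) integral_over1.
rewrite /integral_over -![foldr _ _ _]/(iint mu (enum P) _).
rewrite -iintZ// -iintZ// -iintD; [|exact: nn_measurableZ..].
apply: le_iint; first exact: nn_measurable_integral.
  by apply: nn_measurableD; exact: nn_measurableZ.
by move=> w _; exact: fibre_info_forget.
Qed.

End Forget.

Lemma fisher_ge0 (U V : {set var n}) : [disjoint U & V]%B ->
  (0 <= fisher mu p q theta U V)%E.
Proof.
move=> dUV; rewrite fisherE//.
exact: (nn_measurable_iint mu (enum V) (fibre_info_nn_measurable dUV)).1.
Qed.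

End Information.

(** * Choice of the constants in the three bounds *)

Unset Implicit Arguments.

Theorem lemma4 (R : realType) :
  exists C : R, 0 < C /\
  forall (n : nat) (d : var n -> measure_display)
    (T : forall v : var n, measurableType (d v))
    (mu : forall v : var n, {sigma_finite_measure set (T v) -> \bar R})
    (alpha : R) (Theta : set R)
    (p : R -> config T -> R) (q : 'I_n -> config T -> R),
  0 < alpha -> open Theta ->
  density_family mu Theta p -> ldp_mechanism mu alpha q ->
  regular mu p q Theta ->
  forall theta : R, Theta theta ->
  let I (U V : {set var n}) : \bar R := fisher mu p q theta U V in
  [/\ forall i : 'I_n,
        (I [set inr i]%SET (pastZ n i) <=
           (C * (expR alpha - 1) ^+ 2)%:E * I [set inl i]%SET (pastZ n i))%E,
      forall (i j : 'I_n) (eps : R), i = j.+1 :> nat -> 0 < eps ->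
        (I [set inl i]%SET (pastZ n i) <=
           ((1 + eps^-1) * (expR alpha - 1) ^+ 2)%:E *
             I [set inl i; inl j]%SET (pastZ n j) +
           ((1 + eps) * expR (2 * alpha))%:E *
             I [set inl i]%SET (pastZ n j))%E
    & forall i j : 'I_n, i = j.+1 :> nat ->
        (I [set inl i]%SET (pastZ n i) <=
           (1 + 9%:R / 4%:R * (expR alpha - 1) ^+ 2)%:E *
             (I [set inl i; inl j]%SET (pastZ n j) +
              I [set inl i]%SET (pastZ n j)))%E].
Proof.
(* The constant of [fisher_privatized]. *)
exists 2; split=> // n d T mu alpha Theta p q a0 oT pd qm reg theta Tt I.
have I_ge0 (i j : 'I_n) (U : {set var n}) : U \subset allX n ->
    (0 <= I U (pastZ n j))%E.
  move=> UX; apply: (fisher_ge0 oT pd qm reg Tt).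
  rewrite -setI_eq0; apply/eqP/setP => v; have := fintype.subsetP UX v.
  by case: v => l; rewrite !inE ?andbF//; case: (_ \in U) => // /(_ isT).
have X1 (i : 'I_n) : [set inl i]%SET \subset allX n.
  by rewrite finset.sub1set inE.
have X2 (i j : 'I_n) : [set inl i; inl j]%SET \subset allX n.
  by rewrite finset.subUset !finset.sub1set !inE.
have forget := @fisher_forget _ _ _ _ _ _ _ _ _ a0 oT pd qm reg _ Tt.
split.
- exact: (fisher_privatized a0 oT pd qm reg Tt).
- move=> i j eps ij eps0; apply: (le_trans (forget i j ij eps eps0)).
  apply: leeD2l; apply: lee_wpmul2r; first exact: I_ge0.
  (* [fisher_forget] already gives the coefficient [1 + eps], and [expR (2 * alpha)] is at least
     1. *)
  rewrite lee_fin ler_peMr//; first by rewrite addr_ge0// ltW.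
  by rewrite -expR0 ler_expR mulr_ge0// ltW.
- move=> i j ij; set K := (expR alpha - 1) ^+ 2.
  have K0 : 0 < K.
    by rewrite exprn_gt0// subr_gt0 -expR0 ltr_expR.
  have eps0 : 0 < 9%:R / 4%:R * K by rewrite mulr_gt0.
  apply: (le_trans (forget i j ij _ eps0)); rewrite -/K.
  rewrite ge0_muleDr; [|exact: I_ge0..].
  apply: leeD => //; apply: lee_wpmul2r; first exact: I_ge0.
  rewrite lee_fin.
  (* For [eps = 9/4 * K] the second coefficient [1 + eps] is the target itself, and this first one
     lies below it. *)
  have -> : (1 + (9%:R / 4%:R * K)^-1) * K = K + 4%:R / 9%:R.
    by field; rewrite gt_eqF.
  lra.
Qed.
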